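(* Let $m\ge 1$, $\epsilon>0$, $b_{\max}>0$. Consider the randomized mechanism $M_P$ which, on a database $b=(b_1,\dots,b_m)\in\mathbb{R}^m$, outputs $M_P(b)=b+w_P$, where $w_P\in\mathbb{R}^m$ is a random vector whose probability density is proportional to $\exp\!\left(-\epsilon\|w_P\|_2/(\sqrt{m}\,b_{\max})\right)$. Then $M_P$ is $\epsilon$-differentially private with respect to the adjacency relation $\mathrm{Adj}(b,b')\iff\max_{i}|b_i-b_i'|\le b_{\max}$.
   Context: A randomized mechanism $M$ from a set of databases $\mathcal{D}$ to a target space $\mathcal{Q}$ is $\epsilon$-differentially private (with respect to a symmetric adjacency relation $\mathrm{Adj}$ on $\mathcal{D}$) if for all measurable $\mathcal{R}\subseteq\mathcal{Q}$ and all pairs $D,D'$ with $\mathrm{Adj}(D,D')$, $\mathbb{P}(M(D)\in\mathcal{R})\le e^{\epsilon}\,\mathbb{P}(M(D')\in\mathcal{R})$. Here $\mathcal{D}=\mathcal{Q}=\mathbb{R}^m$. The distribution of the noise $w_P$ does not depend on $b$. *)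

(* Defs.v *)
(* R^m is m.-tuple R, equipped by the library with the product (i.e. Borel)
   sigma-algebra, generated by the coordinate projections. *)
From HB Require Import structures.
From mathcomp Require Import all_boot all_order all_algebra.
From mathcomp Require Import all_classical all_reals all_analysis.
From mathcomp Require Import measurable_realfun.

Set Implicit Arguments.
Unset Strict Implicit.
Unset Printing Implicit Defensive.

Import Order.TTheory GRing.Theory Num.Theory.
Import numFieldNormedType.Exports.

Local Open Scope classical_set_scope.
Local Open Scope ring_scope.

Section lebesgue_tuple.
Context {R : realType}.

Definition tcons n (p : measurableTypeR R * n.-tuple R) : n.+1.-tuple R :=
  [tuple of p.1 :: p.2].

Lemma measurable_tcons n : measurable_fun [set: _] (@tcons n).
Proof.
by apply: measurable_cons; [exact: measurable_fst|exact: measurable_snd].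
Qed.

HB.instance Definition _ n :=
  isMeasurableFun.Build _ _ _ _ (@tcons n) (@measurable_tcons n).

Section step.
Variables (n : nat) (mu : {sigma_finite_measure set (n.-tuple R) -> \bar R}).

Definition lebesgue_tupleS : set (n.+1.-tuple R) -> \bar R :=
  pushforward (lebesgue_measure \x mu)%E (@tcons n).

Let lebesgue_tupleS0 : lebesgue_tupleS set0 = 0%E.
Proof. exact: measure0. Qed.

Let lebesgue_tupleS_ge0 A : (0 <= lebesgue_tupleS A)%E.
Proof. exact: measure_ge0. Qed.

Let lebesgue_tupleS_sigma_additive : semi_sigma_additive lebesgue_tupleS.
Proof. exact: measure_semi_sigma_additive. Qed.

HB.instance Definition _ := isMeasure.Build _ _ _ lebesgue_tupleS
  lebesgue_tupleS0 lebesgue_tupleS_ge0 lebesgue_tupleS_sigma_additive.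

Let lebesgue_tupleS_sigma_finite : sigma_finite setT lebesgue_tupleS.
Proof.
have /sigma_finiteP[F [TF ndF Foo]] := sigma_finiteT (@lebesgue_measure R).
have /sigma_finiteP[G [TG ndG Goo]] := sigma_finiteT mu.
pose h (t : n.+1.-tuple R) : measurableTypeR R := tnth t ord0.
pose u (t : n.+1.-tuple R) : n.-tuple R := [tuple of behead t].
exists (fun k => h @^-1` F k `&` u @^-1` G k).
  apply/esym; rewrite -subTset => t _.
  have [k _ Fk] : (\bigcup_k F k) (h t) by rewrite -TF.
  have [l _ Gl] : (\bigcup_k G k) (u t) by rewrite -TG.
  exists (maxn k l) => //; split.
  - by apply: (subsetPset _ _ (ndF _ _ (leq_maxl k l))).
  - by apply: (subsetPset _ _ (ndG _ _ (leq_maxr k l))).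
move=> k; have [mF Fk] := Foo k; have [mG Gk] := Goo k; split.
  apply: measurableI; rewrite -[X in measurable X]setTI.
    exact: (measurable_tnth ord0).
  exact: measurable_behead.
rewrite /lebesgue_tupleS /pushforward.
rewrite [X in product_measure1 _ _ X](_ : _ = F k `*` G k); last first.
  have uE p : u (tcons p) = p.2 by exact/val_inj.
  by apply/seteqP; split => p /=; rewrite uE.
by rewrite product_measure1E// lte_mul_pinfty// ge0_fin_numE.
Qed.

HB.instance Definition _ := @Measure_isSigmaFinite.Build _ _ _ lebesgue_tupleS
  lebesgue_tupleS_sigma_finite.

End step.

(* m-dimensional Lebesgue measure, as an iterated product. *)
Fixpoint lebesgue_tuple m : {sigma_finite_measure set (m.-tuple R) -> \bar R} :=
  match m with
  | 0 => \d_([tuple] : 0.-tuple R)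
  | n.+1 => lebesgue_tupleS (lebesgue_tuple n)
  end.

(* Sanity check: boxes have the expected volume. *)
Lemma lebesgue_tuple_box m (A : 'I_m -> set R) :
  (forall i, measurable (A i)) ->
  lebesgue_tuple m [set t | forall i, A i (tnth t i)] =
  (\prod_(i < m) lebesgue_measure (A i))%E.
Proof.
elim: m A => [|m IH] A mA /=.
  by rewrite big_ord0 diracE mem_set // => -[].
rewrite big_ord_recl -(IH (fun i => A (lift ord0 i)))//.
rewrite /lebesgue_tupleS /pushforward.
pose B : set (m.-tuple R) := [set t | forall i, A (lift ord0 i) (tnth t i)].
have mB : measurable B.
  rewrite [X in measurable X](_ : B = \bigcap_(i in [set: 'I_m])
      ((@tnth m R ^~ i) @^-1` A (lift ord0 i))).
    apply: fin_bigcap_measurable => // i _.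
    rewrite -[X in measurable X]setTI.
    exact: measurable_tnth.
  by apply/seteqP; split=> t h i => [_|]; exact: h.
transitivity ((@lebesgue_measure R \x lebesgue_tuple m)%E (A ord0 `*` B)).
  2: exact: (product_measure1E lebesgue_measure (lebesgue_tuple m) (mA ord0) mB).
congr (product_measure1 _ _ _); apply/seteqP; split=> -[x t] /=.
  by move=> h; split => [|i]; [exact: (h ord0)|have := h (lift ord0 i); rewrite tnthS].
move=> [Ax Bt] i; case: (unliftP ord0 i) => [j ->|->]//.
by rewrite tnthS; exact: Bt.
Qed.

End lebesgue_tuple.

Section euclidean_space.
Context {R : realType} {m : nat}.
Implicit Types x y : m.-tuple R.

Definition tadd x y : m.-tuple R := [tuple tnth x i + tnth y i | i < m].

Definition norm2 x : R := Num.sqrt (\sum_(i < m) tnth x i ^+ 2).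

(* The identity 0 is harmless: all the terms are nonnegative. *)
Definition dist_max x y : R :=
  \big[Num.max/0]_(i < m) `|tnth x i - tnth y i|.

Lemma measurable_tadd x : measurable_fun [set: m.-tuple R] (tadd x).
Proof.
apply/measurable_fun_tnthP => i.
rewrite (_ : _ \o _ = fun y => tnth x i + tnth y i); last first.
  by apply/funext => y /=; rewrite tnth_mktuple.
by apply: measurable_funD => //; exact: measurable_tnth.
Qed.

End euclidean_space.

Section probability_density.
Context {R : realType} {m : nat} d (Omega : measurableType d).
Context (P : probability Omega R).

Definition has_density (X : {RV P >-> m.-tuple R}) (f : m.-tuple R -> R) : Prop :=
  [/\ measurable_fun [set: m.-tuple R] f,
      forall x, 0 <= f x &
      forall A, measurable A ->
        distribution P X A = (\int[lebesgue_tuple m]_(x in A) (f x)%:E)%E].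

Definition density_proportional_to (X : {RV P >-> m.-tuple R})
    (g : m.-tuple R -> R) : Prop :=
  exists c : R, has_density X (fun x => c * g x).

End probability_density.

(* A randomized mechanism is a family of random variables indexed by the
   databases, all defined on the same probability space. *)
Definition differentially_private {R : realType} (D : Type)
    d (Omega : measurableType d) (P : probability Omega R)
    d' (Q : measurableType d') (Adj : D -> D -> Prop) (eps : R)
    (M : D -> {RV P >-> Q}) : Prop :=
  forall (S : set Q) (x x' : D), measurable S -> Adj x x' ->
    (P (M x @^-1` S) <= (expR eps)%:E * P (M x' @^-1` S))%E.

Section additive_noise.
Context {R : realType} {m : nat} d (Omega : measurableType d).
Context (P : probability Omega R) (w : {RV P >-> m.-tuple R}).

Definition add_noise_fun (b : m.-tuple R) : Omega -> m.-tuple R :=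
  fun o => tadd b (w o).

Lemma measurable_add_noise_fun b : measurable_fun [set: Omega] (add_noise_fun b).
Proof. by apply: measurableT_comp; [exact: measurable_tadd|]. Qed.

HB.instance Definition _ b :=
  isMeasurableFun.Build _ _ _ _ (add_noise_fun b) (@measurable_add_noise_fun b).

Definition add_noise (b : m.-tuple R) : {RV P >-> m.-tuple R} := add_noise_fun b.

End additive_noise.

Definition max_adj {R : realType} {m : nat} (b_max : R) (b b' : m.-tuple R) : Prop :=
  dist_max b b' <= b_max.

Lemma max_adj_sym {R : realType} {m : nat} (b_max : R) (b b' : m.-tuple R) :
  max_adj b_max b b' -> max_adj b_max b' b.
Proof.
rewrite /max_adj /dist_max.
by under eq_bigr => i _ do rewrite distrC.
Qed.

(* Main.v *)
(** Lebesgue measure on R^m is translation invariant: in dimension one by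
    uniqueness on intervals, then by induction on m through the sections of the
    product measure. Hence P(b + w \in S) is the integral over {x | b' + x \in S}
    of the density of w at (b' - b) + x. The triangle inequality and
    ||b' - b||_2 <= sqrt(m) b_max bound that density by e^eps times its value
    at x. *)
From HB Require Import structures.
Require Import Defs.
From mathcomp Require Import all_boot all_order all_algebra.
From mathcomp Require Import all_classical all_reals all_analysis.
From mathcomp Require Import measurable_realfun ring lra.

Import Order.TTheory GRing.Theory Num.Theory.
Import numFieldNormedType.Exports.

Local Open Scope classical_set_scope.
Local Open Scope ring_scope.

Lemma lebesgue_measureD (R : realType) (a : R) (A : set R) : measurable A ->
  pushforward lebesgue_measure (+%R a : _ -> measurableTypeR R) A =
  lebesgue_measure A.
Proof.
have mD : measurable_fun setT (+%R a : measurableTypeR R -> measurableTypeR R).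
  exact: measurable_funD.
(* Bundling the translation as a measurable function makes its pushforward a measure, to which
   uniqueness applies. *)
pose D : {mfun measurableTypeR R >-> measurableTypeR R} :=
  HB.pack (+%R a : measurableTypeR R -> measurableTypeR R)
    (isMeasurableFun.Build _ _ _ _ _ mD).
move=> mA; apply/esym.
have := @lebesgue_measure_unique R (pushforward lebesgue_measure D) _ _ mA.
apply => /=.
move=> _ [[x y]] _ <-.
rewrite /pushforward (_ : _ @^-1` _ = [set` `]x - a, y - a]%R]); last first.
  apply/seteqP; split => z /=; rewrite !in_itv/= => /andP[h1 h2];
    apply/andP; split; lra.
rewrite !lebesgue_measure_itv/= !lte_fin ltrD2r -!EFinB.
by case: ifP => // _; congr (_%:E); ring.
Qed.

(** Head and tail are translated independently, which is what the induction through
    [lebesgue_tupleS] needs. *)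
Lemma tadd_tcons (R : realType) n (a : n.+1.-tuple R) (p : R * n.-tuple R) :
  tadd a (tcons p) =
  tcons (tnth a ord0 + p.1, tadd [tuple of behead a] p.2).
Proof.
apply/eq_from_tnth => i; rewrite tnth_mktuple.
case: (unliftP ord0 i) => [j ->|->]; last by rewrite !tnth0.
(* [tnth_behead] produces the index [inord j.+1], to be identified with [lift ord0 j]. *)
by rewrite !tnthS tnth_mktuple tnth_behead; congr (tnth a _ + _); apply/val_inj;
  rewrite /= inordK ?ltnS.
Qed.

Lemma lebesgue_tuple_tadd (R : realType) m (a : m.-tuple R)
    (A : set (m.-tuple R)) : measurable A ->
  lebesgue_tuple m (tadd a @^-1` A) = lebesgue_tuple m A.
Proof.
elim: m a A => [|m IH] a A mA /=.
  suff -> : tadd a @^-1` A = A by [].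
  by apply/seteqP; split => t /=; rewrite (tuple0 (tadd a t)) (tuple0 t).
rewrite /lebesgue_tupleS /pushforward /product_measure1.
set B := @tcons R m @^-1` A.
have mB : measurable B.
  by rewrite -[B]setTI; apply: measurable_tcons.
pose F x := lebesgue_tuple m (xsection B x).
have mF : measurable_fun setT F by exact: measurable_fun_xsection.
(* The induction hypothesis, for the tail of [a], absorbs the translation inside each section; only
   a translation of the first coordinate remains. *)
transitivity (\int[lebesgue_measure]_x F (tnth a ord0 + x)%R)%E.
  apply: eq_integral => x _ /=.
  rewrite /F -[RHS](IH [tuple of behead a]); last exact: measurable_xsection.
  congr (lebesgue_tuple m _); apply/seteqP; split => t /=;
    by rewrite /xsection/= !inE /B/= tadd_tcons.
have mD : measurable_fun setT
    (+%R (tnth a ord0) : measurableTypeR R -> measurableTypeR R).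
  exact: measurable_funD.
rewrite -[LHS](ge0_integral_pushforward mD lebesgue_measure measurableT mF) //.
by apply: eq_measure_integral => C mC _; exact: lebesgue_measureD.
Qed.

Lemma ge0_integral_tadd (R : realType) m (a : m.-tuple R)
    (D : set (m.-tuple R)) (f : m.-tuple R -> \bar R) :
  measurable D -> measurable_fun D f -> {in D, forall x, 0 <= f x}%E ->
  (\int[lebesgue_tuple m]_(x in D) f x =
   \int[lebesgue_tuple m]_(x in tadd a @^-1` D) f (tadd a x))%E.
Proof.
move=> mD mf f0.
rewrite -[RHS](ge0_integral_pushforward (measurable_tadd a)
  (lebesgue_tuple m) mD mf f0).
apply: eq_measure_integral => [|mta C mC _]; first exact: measurable_tadd.
exact/esym/lebesgue_tuple_tadd.
Qed.

Section norm2.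
Context {R : realType} {m : nat}.
Implicit Types x y a : m.-tuple R.

Lemma norm2_ge0 x : 0 <= norm2 x.
Proof. exact: sqrtr_ge0. Qed.

Lemma sqr_norm2 x : norm2 x ^+ 2 = \sum_(i < m) tnth x i ^+ 2.
Proof. by rewrite sqr_sqrtr// sumr_ge0// => i _; exact: sqr_ge0. Qed.

Lemma norm2_eq0_tnth x i : norm2 x = 0 -> tnth x i = 0.
Proof.
move=> x0; have := sqr_norm2 x; rewrite x0 expr0n/= => /esym/eqP.
rewrite psumr_eq0; last by move=> j _; exact: sqr_ge0.
by move=> /allP/(_ i (mem_index_enum i)); rewrite sqrf_eq0 => /eqP.
Qed.

(** For nonzero norms, expanding the nonnegative sum of [(norm2 y * x_i - norm2 x * y_i) ^+ 2] gives
    the bound times [2 * (norm2 x * norm2 y)]. *)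
Lemma cauchy_schwarz_norm2 x y :
  \sum_(i < m) tnth x i * tnth y i <= norm2 x * norm2 y.
Proof.
have [x0|x0] := eqVneq (norm2 x) 0.
  by rewrite x0 mul0r big1// => i _; rewrite norm2_eq0_tnth// mul0r.
have [y0|y0] := eqVneq (norm2 y) 0.
  by rewrite y0 mulr0 big1// => i _; rewrite (norm2_eq0_tnth y)// mulr0.
have xy0 : 0 < norm2 x * norm2 y.
  by rewrite mulr_gt0// lt_neqAle norm2_ge0 eq_sym ?x0 ?y0.
have : 0 <= \sum_(i < m) (norm2 y * tnth x i - norm2 x * tnth y i) ^+ 2.
  by apply: sumr_ge0 => i _; exact: sqr_ge0.
have sqrE i : (norm2 y * tnth x i - norm2 x * tnth y i) ^+ 2 =
    norm2 y ^+ 2 * tnth x i ^+ 2 + norm2 x ^+ 2 * tnth y i ^+ 2 -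
    2 * (norm2 x * norm2 y) * (tnth x i * tnth y i) by ring.
rewrite (eq_bigr _ (fun i _ => sqrE i)).
rewrite sumrB big_split/= -!mulr_sumr -!sqr_norm2 => h.
by rewrite -(ler_pM2l xy0); lra.
Qed.

(** This is the triangle inequality for [x = (a + x) + (- a)]: after squaring, Cauchy-Schwarz bounds
    the cross term. *)
Lemma norm2_le_tadd a x : norm2 x <= norm2 (tadd a x) + norm2 a.
Proof.
have a0 := norm2_ge0 a; have ax0 := norm2_ge0 (tadd a x).
rewrite -(@ler_pXn2r _ 2%N)// ?nnegrE ?norm2_ge0 ?addr_ge0//.
pose na : m.-tuple R := [tuple - tnth a i | i < m].
have naE : norm2 na = norm2 a.
  by congr Num.sqrt; apply: eq_bigr => i _; rewrite tnth_mktuple sqrrN.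
have := cauchy_schwarz_norm2 (tadd a x) na; rewrite naE.
have -> : norm2 x ^+ 2 = norm2 (tadd a x) ^+ 2 + norm2 a ^+ 2 +
    2 * \sum_(i < m) tnth (tadd a x) i * tnth na i.
  rewrite !sqr_norm2 mulr_sumr -!big_split/=; apply: eq_bigr => i _.
  by rewrite !tnth_mktuple; ring.
lra.
Qed.

Lemma norm2_le_max (c : R) x : 0 <= c -> (forall i, `|tnth x i| <= c) ->
  norm2 x <= Num.sqrt m%:R * c.
Proof.
move=> c0 xc; rewrite -(@ler_pXn2r _ 2%N)// ?nnegrE ?norm2_ge0//; last first.
  by rewrite mulr_ge0// sqrtr_ge0.
rewrite sqr_norm2 exprMn sqr_sqrtr//.
have -> : m%:R * c ^+ 2 = \sum_(i < m) c ^+ 2.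
  by rewrite sumr_const card_ord mulr_natl.
by apply: ler_sum => i _; rewrite -real_normK ?num_real// lerXn2r// nnegrE.
Qed.

End norm2.

Theorem theorem16 (R : realType) (m : nat) (eps b_max : R)
    (d : measure_display) (Omega : measurableType d) (P : probability Omega R)
    (w : {RV P >-> m.-tuple R}) :
  (1 <= m)%N -> 0 < eps -> 0 < b_max ->
  density_proportional_to w
    (fun x => expR (- (eps * norm2 x / (Num.sqrt m%:R * b_max)))) ->
  differentially_private (max_adj b_max) eps (add_noise w).
Proof.
pose g (x : m.-tuple R) := expR (- (eps * norm2 x / (Num.sqrt m%:R * b_max))).
move=> m1 eps0 bmax0 [c]; pose f x := c * g x.
rewrite -/f => -[mf f0 wf] S b b' mS adj.
have mtS e : measurable (tadd e @^-1` S).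
  by rewrite -[X in measurable X]setTI; exact: measurable_tadd.
have PE e : P (add_noise w e @^-1` S) =
    (\int[lebesgue_tuple m]_(x in tadd e @^-1` S) (f x)%:E)%E.
  by rewrite -wf.
(* The sign of the normalizing constant is read off from the nonnegativity of the density at any
   point, here [b]. *)
have c0 : 0 <= c.
  by have := f0 b; rewrite /f pmulr_lge0// expR_gt0.
(* Translating by [a = b' - b] and then by [b] amounts to translating by [b']. *)
pose a : m.-tuple R := [tuple tnth b' i - tnth b i | i < m].
have tSE : tadd a @^-1` (tadd b @^-1` S) = tadd b' @^-1` S.
  suff ab x : tadd b (tadd a x) = tadd b' x.
    by apply/seteqP; split => x /=; rewrite ab.
  by apply/eq_from_tnth => i; rewrite !tnth_mktuple; ring.
have s0 : 0 < Num.sqrt m%:R * b_max by rewrite mulr_gt0// sqrtr_gt0 ltr0n.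
have na : norm2 a <= Num.sqrt m%:R * b_max.
  apply: norm2_le_max; first exact: ltW.
  move=> i; rewrite tnth_mktuple distrC; apply: le_trans adj.
  by apply: (le_bigmax _ (fun i => `|tnth b i - tnth b' i|)).
have fa x : f (tadd a x) <= expR eps * f x.
  rewrite /f mulrCA ler_wpM2l// /g -expRD ler_expR.
  suff : eps * norm2 x / (Num.sqrt m%:R * b_max) <=
      eps * norm2 (tadd a x) / (Num.sqrt m%:R * b_max) + eps by lra.
  (* Writing [eps] as [eps * s / s], with [s] the scale [Num.sqrt m%:R * b_max], lets [eps] and [s]
     cancel and leaves [norm2 x <= norm2 (tadd a x) + s]. *)
  rewrite -[X in _ + X](mulfK (lt0r_neq0 s0)) -mulrDl ler_pM2r ?invr_gt0//.
  rewrite -mulrDr ler_pM2l//; apply: le_trans (norm2_le_tadd a x) _.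
  by rewrite lerD2l.
have mfE D : measurable_fun D (fun x => (f x)%:E).
  by apply/measurable_EFinP; exact: measurable_funTS.
(* Substituting [tadd a x] on the left puts both integrals over the same domain, so [fa] can be
   integrated. *)
rewrite !PE (ge0_integral_tadd _ _ a)//; last by move=> x _; rewrite lee_fin.
rewrite tSE -ge0_integralZl_EFin//; last by move=> x _; rewrite lee_fin.
apply: ge0_le_integral => //.
- by move=> x _; rewrite lee_fin.
- apply: measurable_funTS; apply: (measurableT_comp (mfE setT)).
  exact: measurable_tadd.
- exact: measurable_funeM.
- by move=> x _; rewrite -EFinM lee_fin.
Qed.
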